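(* Let $M=(E,\mathcal{I})$ be a finite matroid and let $x,y\in E$ be distinct. In the matroid independent set toggle group $T(\mathcal{I})$, $(t_xt_y)^2=1$ if and only if no circuit of $M$ contains both $x$ and $y$.
   Context: $\mathcal{I}\subseteq 2^E$ is the set of independent sets of the matroid $M$ on the finite ground set $E$; a circuit is a minimal dependent (non-independent) subset of $E$. For $x\in E$ the toggle $t_x:\mathcal{I}\to\mathcal{I}$ is given by $t_x(X)=X\cup\{x\}$ if $x\notin X$ and $X\cup\{x\}\in\mathcal{I}$; $t_x(X)=X\setminus\{x\}$ if $x\in X$ and $X\setminus\{x\}\in\mathcal{I}$; and $t_x(X)=X$ otherwise. $T(\mathcal{I})$ is the subgroup of the symmetric group on $\mathcal{I}$ generated by all $t_x$, $x\in E$. *)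

(* Defs.v *)
From mathcomp Require Import all_boot all_fingroup.

Set Implicit Arguments.
Unset Strict Implicit.
Unset Printing Implicit Defensive.

Local Open Scope group_scope.

(* The ground set is the whole finite type [E]. *)
Record matroid (E : finType) := Matroid {
  indep : {set {set E}};
  indep0 : set0 \in indep;
  indep_sub : forall A B : {set E}, A \subset B -> B \in indep -> A \in indep;
  indep_aug : forall A B : {set E}, A \in indep -> B \in indep ->
    #|A| < #|B| -> exists2 x, x \in B :\: A & x |: A \in indep
}.

Definition circuit (E : finType) (M : matroid E) (C : {set E}) : bool :=
  minset (fun A => A \notin indep M) C.

Definition indep_set (E : finType) (M : matroid E) : finType :=
  {X : {set E} | X \in indep M}.

Definition toggle_set (E : finType) (M : matroid E) (x : E) (X : {set E}) :
    {set E} :=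
  if (x \notin X) && (x |: X \in indep M) then x |: X
  else if (x \in X) && (X :\ x \in indep M) then X :\ x
  else X.

Lemma toggle_set_indep (E : finType) (M : matroid E) (x : E) (X : {set E}) :
  X \in indep M -> toggle_set M x X \in indep M.
Proof.
by move=> XI; rewrite /toggle_set; case: ifP => [/andP[]//|_];
  case: ifP => [/andP[]|].
Qed.

Definition toggle_fun (E : finType) (M : matroid E) (x : E)
    (X : indep_set M) : indep_set M :=
  exist _ (toggle_set M x (val X)) (toggle_set_indep x (valP X)).

Lemma toggle_funK (E : finType) (M : matroid E) (x : E) :
  involutive (@toggle_fun E M x).
Proof.
case=> X XI; apply: val_inj; rewrite /= {2}/toggle_set.
case xX: (x \in X) => /=.
  case: ifP => [_|DI]; rewrite /toggle_set ?xX /= ?DI //.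
  by rewrite setD11 /= setD1K // XI.
case: ifP => [_|UI]; rewrite /toggle_set ?xX /= ?UI //.
by rewrite setU11 /= setU1K ?xX // XI.
Qed.

Definition toggle (E : finType) (M : matroid E) (x : E) :
    {perm indep_set M} :=
  perm (inv_inj (@toggle_funK E M x)).

Definition toggle_group (E : finType) (M : matroid E) :
    {group {perm indep_set M}} :=
  <<[set toggle M x | x : E]>>%G.

Lemma mem_toggle (E : finType) (M : matroid E) (x : E) :
  toggle M x \in toggle_group M.
Proof. by apply: mem_gen; apply: imset_f. Qed.

(* [s * t] in a permutation group applies [s] first; under the opposite
   convention [(t_x t_y)^2] becomes its inverse. *)
Definition toggle_gen (E : finType) (M : matroid E) (x : E) :
    [subg toggle_group M] :=
  Subg (mem_toggle M x).

(* Main.v *)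
(* Two involutions satisfy [(s * t) ^+ 2 = 1] iff they commute. On a circuit
   [C] minus its elements [x] and [y], the two orders of toggling give [C :\ y]
   and [C :\ x]. Conversely, toggling [y] can only affect whether [x] may be
   added to [X] if some [A], [x |: A] and [y |: A] are independent while
   [x |: (y |: A)] is not, and then every circuit inside the latter contains
   both [x] and [y]. *)
Require Import Defs.
From mathcomp Require Import all_boot all_fingroup.

Local Open Scope group_scope.

Lemma involution_mul_expg2 {gT : finGroupType} {s t : gT} :
  s * s = 1 -> t * t = 1 -> (s * t) ^+ 2 = 1 <-> s * t = t * s.
Proof.
move=> ss tt.
rewrite expgS expg1; split=> [stst|st].
  by apply: (mulIg (s * t)); rewrite stst -mulgA (mulgA s s) ss mul1g tt.
by rewrite {2}st mulgA -(mulgA s t t) tt mulg1 ss.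
Qed.

Section Toggle.

Set Implicit Arguments.
Unset Strict Implicit.

Variables (E : finType) (M : matroid E).
Implicit Types (x y z : E) (A X C : {set E}).

(** Independence is hereditary, so removing [x] always succeeds and only adding it can be blocked.
    Later set equalities reduce to comparing this membership test. *)
Lemma mem_toggle_set x z X : X \in indep M ->
  (z \in toggle_set M x X) =
    if z == x then (x \notin X) && (x |: X \in indep M) else z \in X.
Proof.
move=> XI; rewrite /toggle_set.
have DI : X :\ x \in indep M by rewrite (indep_sub _ XI) ?subsetDl.
case xX: (x \in X) => /=; rewrite ?DI.
  by rewrite !inE; case: eqVneq.
case: ifP => UI; rewrite ?inE; case: eqVneq => // ->.
by rewrite xX.
Qed.

Lemma toggle_gen_expg2P x y :
  (toggle_gen M x * toggle_gen M y) ^+ 2 = 1 <->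
  (forall X, X \in indep M ->
     toggle_set M y (toggle_set M x X) = toggle_set M x (toggle_set M y X)).
Proof.
have invol z : toggle_gen M z * toggle_gen M z = 1.
  apply: val_inj => /=; apply/permP => X.
  by rewrite permM !permE toggle_funK.
apply: (iff_trans (involution_mul_expg2 (invol x) (invol y))).
split=> [txy X XI | txy].
  have /permP/(_ (exist _ X XI)) := congr1 val txy.
  by rewrite !permM !permE => /(congr1 val).
apply: val_inj => /=; apply/permP => -[X XI].
by rewrite !permM !permE; apply: val_inj; apply: txy.
Qed.

Lemma circuit_dep C : circuit M C -> C \notin indep M.
Proof. by case/minsetP. Qed.

Lemma circuitD1_indep C x : circuit M C -> x \in C -> C :\ x \in indep M.
Proof.
case/minsetP=> _ minC xC; apply: contraT => /minC/(_ (subsetDl _ _)) CE.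
by rewrite -CE !inE eqxx in xC.
Qed.

(** A dependent subset avoiding [x] would lie in [y |: A], and one avoiding [y] in [x |: A]; both
    are independent. *)
Lemma dep_setU2_circuit x y A :
  x |: A \in indep M -> y |: A \in indep M -> x |: (y |: A) \notin indep M ->
  exists C, circuit M C /\ x \in C /\ y \in C.
Proof.
move=> xA yA /(minset_exists (P := fun B => B \notin indep M)) [C cC sC].
have dC := circuit_dep cC.
exists C; split; first exact: cC.
split; apply: contraR dC => nC; [apply: indep_sub yA|apply: indep_sub xA].
  apply/subsetP => z zC; move: (subsetP sC z zC); rewrite !inE.
  by case: eqVneq => [zx|//]; rewrite -zx zC in nC.
apply/subsetP => z zC; move: (subsetP sC z zC); rewrite !inE.
by case: (eqVneq z y) => [zy|//]; rewrite -zy zC in nC.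
Qed.

Lemma setU1_toggle_indep x y X :
  ~ (exists C, circuit M C /\ x \in C /\ y \in C) -> X \in indep M ->
  (x |: toggle_set M y X \in indep M) = (x |: X \in indep M).
Proof.
move=> noC XI.
have addxy A : y |: A \in indep M ->
    (x |: A \in indep M) = (x |: (y |: A) \in indep M).
  move=> yA; apply/idP/idP => [xA|]; last first.
    by apply: indep_sub; rewrite setUS ?subsetUr.
  by apply: contraT => /(dep_setU2_circuit xA yA)/noC.
rewrite /toggle_set; case: ifP => [/andP[_ yX]|_]; first by rewrite -addxy.
(* Removal of [y] is addition read backwards: [addxy] is used at [A := X :\ y]. *)
by case: ifP => [/andP[yX _]|//]; rewrite addxy setD1K.
Qed.

Lemma toggle_set_comm x y X : x != y ->
  ~ (exists C, circuit M C /\ x \in C /\ y \in C) -> X \in indep M ->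
  toggle_set M y (toggle_set M x X) = toggle_set M x (toggle_set M y X).
Proof.
move=> xy noC XI.
have noC' : ~ exists C, circuit M C /\ y \in C /\ x \in C.
  by case=> C [cC [yC xC]]; apply: noC; exists C.
apply/setP => z; rewrite !mem_toggle_set ?toggle_set_indep //.
(* Each toggle leaves unchanged both the presence of the other element and whether it may be
   added. *)
rewrite !setU1_toggle_indep // (eq_sym y) (negPf xy).
by case: (eqVneq z x) => [->|_]; rewrite ?(negPf xy).
Qed.

(** The two results differ at [x]. Toggling [x] first inserts it, and toggling [y] then keeps it;
    toggling [y] first gives [C :\ x], where adding [x] would complete the dependent set [C]. *)
Lemma circuit_toggle_ncomm x y C : x != y ->
  circuit M C -> x \in C -> y \in C ->
  toggle_set M y (toggle_set M x (C :\ x :\ y)) <>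
  toggle_set M x (toggle_set M y (C :\ x :\ y)).
Proof.
move=> xy cC xC yC; set X := C :\ x :\ y.
have XI : X \in indep M.
  exact: indep_sub (subsetDl _ _) (circuitD1_indep cC xC).
have xX : x |: X = C :\ y.
  rewrite /X; apply/setP => z; rewrite !inE.
  by case: (eqVneq z x) => [->|] //=; rewrite xy xC.
have tyX : toggle_set M y X = C :\ x.
  have yX : y |: X = C :\ x by rewrite setD1K // !inE eq_sym xy.
  by rewrite /toggle_set yX setD11 (circuitD1_indep cC xC).
move/setP/(_ x); rewrite !mem_toggle_set ?toggle_set_indep //.
rewrite eqxx (negPf xy) tyX setD1K // (negPf (circuit_dep cC)) andbF.
by rewrite xX (circuitD1_indep cC yC) !inE eqxx andbF.
Qed.

End Toggle.

Theorem lemma3p36 (E : finType) (M : matroid E) (x y : E) (hxy : x <> y) :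
  (toggle_gen M x * toggle_gen M y) ^+ 2 = 1 <->
  ~ (exists C : {set E}, circuit M C /\ x \in C /\ y \in C).
Proof.
have xy : x != y by apply/eqP.
apply: (iff_trans (toggle_gen_expg2P M x y)); split=> [txy [C [cC [xC yC]]]|noC X].
  apply: (circuit_toggle_ncomm xy cC xC yC); apply: txy.
  exact: indep_sub (subsetDl _ _) (circuitD1_indep cC xC).
exact: toggle_set_comm.
Qed.
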